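(* For all $H\in(0,1)\setminus\{\frac12\}$ and all $(a,b)\in\mathbb{R}^2\setminus\{(0,0)\}$, the generalized fractional Brownian motion $(Z_t^H(a,b))_{t\ge0}$ with parameters $a,b,H$ is not a Markov process.
   Context: For $H\in(0,1)$, a two-sided fractional Brownian motion with Hurst parameter $H$ is a centered Gaussian process $B^H=(B_t^H)_{t\in\mathbb{R}}$ on a probability space $(\Omega,F,\mathbb{P})$ with covariance $\operatorname{Cov}(B_t^H,B_s^H)=\frac12\bigl(|s|^{2H}+|t|^{2H}-|t-s|^{2H}\bigr)$ for $s,t\in\mathbb{R}$. For real $a,b$ with $(a,b)\ne(0,0)$, the generalized fractional Brownian motion (gfBm) with parameters $a,b,H$ is the process $Z^H=(Z_t^H)_{t\ge0}$ defined by $Z_t^H=Z_t^H(a,b)=aB_t^H+bB_{-t}^H$ for $t\ge 0$. The Markov property is understood with respect to the natural filtration of the process. *)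

(* Defs.v *)
From HB Require Import structures.
From mathcomp Require Export all_boot all_order all_algebra.
From mathcomp Require Export all_classical all_reals all_analysis.

Set Implicit Arguments.
Unset Strict Implicit.
Unset Printing Implicit Defensive.

Import Order.TTheory GRing.Theory Num.Theory.
Import numFieldNormedType.Exports.

Local Open Scope classical_set_scope.
Local Open Scope ring_scope.

Section gaussian.
Context {d : measure_display} {T : measurableType d} {R : realType}.
Variable P : probability T R.

(* Degenerate laws are Gaussian. They are split off because [normal_prob m 0]
   is by convention a uniform law, not the Dirac mass at [m]. *)
Definition gaussian_rv (X : T -> R) : Prop :=
  exists m s : R, forall A : set R, measurable A ->
    pushforward P X A = if s == 0 then \d_m A else normal_prob m s A.

Definition gaussian_process (I : Type) (X : I -> {RV P >-> R}) : Prop :=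
  forall (n : nat) (t : 'I_n -> I) (c : 'I_n -> R),
    gaussian_rv (fun w => \sum_(i < n) c i * X (t i) w).

Definition two_sided_fbm (H : R) (B : R -> {RV P >-> R}) : Prop :=
  [/\ gaussian_process B,
      forall t, ('E_P[B t] = 0)%E
    & forall s t, covariance P (B t) (B s) =
        (2^-1 * (`|s| `^ (2 * H) + `|t| `^ (2 * H) - `|t - s| `^ (2 * H)))%:E].

(* Only the values at times [0 <= t] are meaningful. *)
Definition gfbm (a b : R) (B : R -> {RV P >-> R}) (t : R) : T -> R :=
  fun w => a * B t w + b * B (- t) w.

End gaussian.

Section markov.
Context {d : measure_display} {T : measurableType d} {R : realType}.
Variable P : probability T R.

(* [Y] is a version of the conditional expectation of [X] given the
   sub-sigma-algebra [G]. *)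
Definition is_cond_expectation (G : set_system T) (X Y : T -> R) : Prop :=
  [/\ forall A : set R, measurable A -> G (Y @^-1` A),
      P.-integrable [set: T] (EFin \o Y)
    & forall A, G A -> (\int[P]_(w in A) (Y w)%:E = \int[P]_(w in A) (X w)%:E)%E].

Definition sigma_rv (X : T -> R) : set_system T :=
  preimage_set_system [set: T] X measurable.

(* The time set of the process [X] is [D]; the values of [X] outside [D] are
   ignored. *)
Definition natural_filtration (D : set R) (X : R -> T -> R) (t : R) :
    set_system T :=
  <<s \bigcup_(r in [set r | D r /\ r <= t]) sigma_rv (X r) >>.

(* E[f(X_t) | F_s] = E[f(X_t) | X_s] almost surely. Conditional expectations
   exist and are unique up to null sets, so the choice of versions [Y] and [Y']
   is immaterial. *)
Definition markov_process (D : set R) (X : R -> T -> R) : Prop :=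
  forall s t : R, D s -> D t -> s <= t ->
  forall f : R -> R, measurable_fun [set: R] f -> bounded_fun f ->
  exists Y Y' : T -> R,
    [/\ is_cond_expectation (natural_filtration D X s) (f \o X t) Y,
        is_cond_expectation (sigma_rv (X s)) (f \o X t) Y'
      & {ae P, forall w, Y w = Y' w}].

End markov.

(* Main.v *)
Require Import Defs.
From mathcomp Require Import all_boot all_order all_algebra.
From mathcomp Require Import all_classical all_reals all_analysis.
From mathcomp Require Import measurable_realfun ring lra.

(** A centered Gaussian process [X] which is Markov satisfies
    [E[X_u X_s] E[X_t^2] = E[X_s X_t] E[X_u X_t]] for [s <= t <= u].  To see it,
    let [U] be the residual of the linear regression of [X_s] on [Y = X_t].
    For every [c], [Y + c U] and [Y - c U] are centered Gaussian with the same
    variance, so [E|Y + c U - q| = E|Y - c U - q|]; the derivative of this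
    identity at [c = 0] reads [E[U sgn (Y - q)] = 0], and letting [q] vary gives
    [E[U | Y] = 0].  By the Markov property [E[U 1_C(X_u)]] equals
    [E[U E[1_C(X_u) | Y]] = 0] for every Borel set [C], hence [E[U X_u] = 0].

    For the gfBm put [h = 2H], [c = a^2 + b^2], [e = 2ab].  By self-similarity
    the identity at the times [x^2 < x < 1] becomes [r(x^2) r(1) = r(x)^2] with
    [r(x) = g(x) - c (1 - x)^h] and [g(x) = (c + e)(1 + x^h) - e (1 + x)^h].
    As [x -> 1] the smooth combination [g(x)^2 - g(x^2) g(1)] is
    [O((1 - x)^2) = o((1 - x)^h)], so the coefficients of [(1 - x)^h] must
    balance: [2 = 2^h], that is [H = 1/2]. *)

Import Order.TTheory GRing.Theory Num.Theory.
Import numFieldNormedType.Exports.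

Local Open Scope classical_set_scope.
Local Open Scope ring_scope.

(** * The covariance of gfBm near the diagonal *)

Section covariance_ratio.
Context {R : realType}.
Implicit Types h c e x : R.

Lemma powR2_eq2 h : (2 : R) `^ h = 2 -> h = 1.
Proof.
move=> /(congr1 (@ln R)); rewrite ln_powR => h2.
have l2 : ln (2:R) != 0 by rewrite gt_eqF// ln_gt0// ltr1n.
by apply: (mulIf l2); rewrite mul1r.
Qed.

Lemma powR2_bounds h : 0 < h < 2 -> 1 < (2 : R) `^ h < 4.
Proof.
move=> /andP[h0 h2]; apply/andP; split.
  rewrite -[ltLHS](powRr0 (2:R)) /powR pnatr_eq0/= ltr_expR ltr_pM2r//.
  by rewrite ln_gt0// ltr1n.
have -> : 4 = (2:R) `^ 2 by rewrite powR_mulrn// -natrX.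
by rewrite /powR pnatr_eq0/= ltr_expR ltr_pM2r// ln_gt0// ltr1n.
Qed.

Definition smooth_part h c e x := (c + e) * (1 + x `^ h) - e * (1 + x) `^ h.
Definition dsmooth_part h c e x :=
  (c + e) * (h * x `^ (h - 1)) - e * (h * (1 + x) `^ (h - 1)).
(* [t^h / 2 * ratio_cov h c e x] is the covariance of the gfBm at the times [t]
   and [t x]; [c (1 - x)^h] is the only part of it which is singular at [1]. *)
Definition ratio_cov h c e x := smooth_part h c e x - c * (1 - x) `^ h.

Lemma is_derive_powR_shift h x : 0 < 1 + x ->
  is_derive x 1 (fun x : R => (1 + x) `^ h) (h * (1 + x) `^ (h - 1)).
Proof.
move=> x0.
have d1 : is_derive x 1 (fun x : R => 1 + x) 1.
  by apply: is_derive_eq; rewrite add0r mulr1.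
have d2 := is_derive1_powR h x0.
by have := @is_derive1_comp R (fun y => y `^ h) (fun x => 1 + x) x _ _ d2 d1; rewrite mulr1.
Qed.

Lemma is_derive_smooth_part h c e x : 0 < x ->
  is_derive x 1 (smooth_part h c e) (dsmooth_part h c e x).
Proof.
move=> x0; rewrite /smooth_part /dsmooth_part.
have ? := is_derive1_powR h x0.
have ? := @is_derive_powR_shift h x (addr_gt0 ltr01 x0).
apply: is_derive_eq; rewrite /GRing.scale/=; ring.
Qed.

Lemma derivable_dsmooth_part h c e x : 0 < x ->
  derivable (dsmooth_part h c e) x 1.
Proof.
move=> x0; rewrite /dsmooth_part.
have ? := is_derive1_powR (h-1) x0.
have ? := @is_derive_powR_shift (h-1) x (addr_gt0 ltr01 x0).
apply: ex_derive.
Qed.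

(** The value is [2 c + (2 - 2^h) e], and [1 < 2^h < 4] gives [|2 - 2^h| < 2]. For the gfBm this is
    twice the variance at time [1]. *)
Lemma smooth_part1_gt0 h c e : 0 < h < 2 -> 0 < c -> `|e| <= c ->
  0 < smooth_part h c e 1.
Proof.
move=> /powR2_bounds /andP[h1 h4] c0; rewrite ler_norml => /andP[ce ec].
rewrite /smooth_part powR1 -[1 + 1]/(2%:R).
by nra.
Qed.

Lemma is_derive_cvg_at_left (f : R -> R) x d : is_derive x 1 f d ->
  f y @[y --> x^'-] --> f x.
Proof.
move=> fd; apply: cvg_at_left_filter; apply: differentiable_continuous.
by apply/derivable1_diffP; exact: ex_derive.
Qed.

Lemma cvg_onem_at_left1 : (fun x : R => 1 - x) @ 1^'- --> 0^'+.
Proof.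
move=> A [e /= e0 eA]; exists e => //= x x1 xlt1; apply: eA => /=.
  by rewrite sub0r normrN.
by rewrite subr_gt0.
Qed.

Lemma cvg_subr1_at_left1 : (fun x : R => x - 1) @ 1^'- --> 0^'.
Proof.
move=> A [e /= e0 eA]; exists e => //= x x1 xlt1; apply: eA => /=.
  by rewrite sub0r opprB.
by rewrite lt_eqF// subr_lt0.
Qed.

Lemma cvg_powR_onem_at_left1 h : 0 < h -> (1 - x) `^ h @[x --> (1 : R)^'-] --> 0.
Proof.
move=> h0; apply: (@cvg_comp _ _ _ (fun x : R => 1 - x) (fun a : R => a `^ h)).
  exact: cvg_onem_at_left1.
exact: powR_cvg0.
Qed.

(** The quotient of [g(x)^2 - g(x^2) g(1)] by [(1 - x)^h] is given two limits at [1] from the left: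
    [c g(1) (2 - 2^h)] by the assumed identity, and [0] by l'Hopital's rule. Since [c g(1) > 0],
    this forces [2^h = 2]. *)
Lemma ratio_cov_not_multiplicative h c e : 0 < h < 2 -> h != 1 -> 0 < c ->
  `|e| <= c ->
  ~ (forall x, 0 < x < 1 ->
     ratio_cov h c e (x * x) * ratio_cov h c e 1 = ratio_cov h c e x ^+ 2).
Proof.
move=> h02 h1 c0 ec mul.
have /andP[h0 h2] := h02.
pose g := smooth_part h c e; pose dg := dsmooth_part h c e.
have g1 : 0 < g 1 by exact: smooth_part1_gt0.
pose G x := g x ^+ 2 - g (x * x) * g 1.
pose dG x := 2 * g x * dg x - 2 * x * dg (x * x) * g 1.
have GdG x : 0 < x -> is_derive x 1 G (dG x).
  move=> x0; rewrite /G /dG.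
  have ? := is_derive_smooth_part h c e x x0.
  have d2 := is_derive_smooth_part h c e (x * x) (mulr_gt0 x0 x0).
  have d1 : is_derive x 1 (fun x : R => x * x) (2 * x).
    by apply: is_derive_eq; rewrite /GRing.scale/=; ring.
  have ? := @is_derive1_comp R g (fun x => x * x) x _ _ d2 d1.
  apply: is_derive_eq; rewrite /GRing.scale/= /dg/g; ring.
have r1 : ratio_cov h c e 1 = g 1.
  by rewrite /ratio_cov subrr powR0 ?mulr0 ?subr0// gt_eqF.
(* The factorization [1 - x^2 = (1 - x) (1 + x)] exposes the same singular factor [(1 - x)^h] in
   [ratio_cov] at [x * x] and at [x], so the division leaves no singularity. *)
have GE x : 0 < x < 1 -> G x / (1 - x) `^ h =
    2 * c * g x - c ^+ 2 * (1 - x) `^ h - c * g 1 * (1 + x) `^ h.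
  move=> /andP[x0 x1].
  have := mul x; rewrite x0 x1 r1 => /(_ isT).
  rewrite /ratio_cov -/(g x) -/(g (x * x)).
  have -> : 1 - x * x = (1 - x) * (1 + x) by ring.
  rewrite powRM ?subr_ge0 ?ltW// ?addr_gt0//.
  have : 0 < (1 - x) `^ h by rewrite powR_gt0// subr_gt0.
  rewrite /G; set p := (1 - x) `^ h; set q := (1 + x) `^ h => p0 E.
  apply: (canLR (mulfK _)); first by rewrite gt_eqF.
  apply/eqP; rewrite -subr_eq0; apply/eqP.
  transitivity ((g x - c * p) ^+ 2 - (g (x * x) - c * (p * q)) * g 1); first by ring.
  by rewrite E subrr.
have cg : g x @[x --> (1 : R)^'-] --> g 1.
  by apply: is_derive_cvg_at_left; exact: is_derive_smooth_part.
have Glim : G x / (1 - x) `^ h @[x --> 1^'-] -->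
    2 * c * g 1 - c ^+ 2 * 0 - c * g 1 * 2 `^ h.
  have : (2 * c * g x - c ^+ 2 * (1 - x) `^ h - c * g 1 * (1 + x) `^ h)
      @[x --> 1^'-] --> 2 * c * g 1 - c ^+ 2 * 0 - c * g 1 * 2 `^ h.
    apply: cvgB; first apply: cvgB.
    - by apply: cvgMr.
    - by apply: cvgMr; exact: cvg_powR_onem_at_left1.
    - apply: cvgMr; apply: (is_derive_cvg_at_left (fun x => (1 + x) `^ h)).
      by apply: is_derive_powR_shift; rewrite addr_gt0.
  apply: cvg_trans; apply: near_eq_cvg.
  near=> x; rewrite GE//; apply/andP; split; near: x.
    by apply: nbhs_left_gt.
  exact: nbhs_left_lt.
have Glim0 : G x / (1 - x) `^ h @[x --> 1^'-] --> 0.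
  apply: (@lhopital_at_left R G dG (fun x => (1 - x) `^ h)
    (fun x => - (h * (1 - x) `^ (h - 1))) 0 1 0 ltr01).
  - by move=> x; rewrite in_itv/= => /andP[x0 _]; exact: GdG.
  - move=> x; rewrite in_itv/= => /andP[_ x1].
    have d1 : is_derive x 1 (fun x : R => 1 - x) (-1).
      by apply: is_derive_eq; rewrite /GRing.scale/=; ring.
    have x10 : 0 < 1 - x by rewrite subr_gt0.
    have d2 := is_derive1_powR h x10.
    have := @is_derive1_comp R (fun y => y `^ h) (fun x => 1 - x) x _ _ d2 d1.
    by rewrite mulrN1.
  - have <- : G 1 = 0 by rewrite /G mulr1 expr2 subrr.
    exact: is_derive_cvg_at_left (GdG _ ltr01).
  - exact: cvg_powR_onem_at_left1.
  - move=> x; rewrite in_itv/= => /andP[_ x1].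
    by rewrite oppr_eq0 mulf_neq0// gt_eqF// powR_gt0// subr_gt0.
  (* The quotient of derivatives is [dG x / (x - 1)] times [(1 - x)^(2 - h) / h]. The first factor
     tends to the derivative of [dG] at [1], because [dG 1 = 0]; the second tends to [0], because
     [h < 2]. *)
  - have dG1 : dG 1 = 0 by rewrite /dG !mulr1; ring.
    have dgd y : 0 < y -> derivable dg y 1 by exact: derivable_dsmooth_part.
    have : derivable dG 1 1.
      have gd := is_derive_smooth_part h c e 1 ltr01.
      have /derivableP dg1 := dgd 1 ltr01.
      have /derivableP d2 : derivable dg (1 * 1) 1 by apply: dgd; rewrite mulr1.
      have d1 : is_derive (1 : R) 1 (fun x : R => x * x) 2.
        by apply: is_derive_eq; rewrite /GRing.scale/=; ring.
      have d3 := @is_derive1_comp R dg (fun x => x * x) 1 _ _ d2 d1.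
      by rewrite /dG; exact: ex_derive.
    move=> /cvg_ex[/= l dGl].
    have : (x - 1)^-1 * dG x @[x --> 1^'-] --> l.
      have := @cvg_comp _ _ _ _ _ _ _ _ cvg_subr1_at_left1 dGl.
      apply: cvg_trans; apply: near_eq_cvg; near=> x.
      by rewrite /= dG1 subr0 /GRing.scale/= mulr1 subrK.
    have := cvg_powR_onem_at_left1 (2 - h) _.
    rewrite subr_gt0 => /(_ h2) pc dGc.
    have : (x - 1)^-1 * dG x * ((1 - x) `^ (2 - h) * h^-1) @[x --> 1^'-] -->
      l * (0 * h^-1) by apply: cvgM => //; exact: cvgMl.
    rewrite mul0r mulr0; apply: cvg_trans; apply: near_eq_cvg; near=> x.
    have x1 : 0 < 1 - x by rewrite subr_gt0; near: x; exact: nbhs_left_lt.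
    have -> : 2 - h = 1 - (h - 1) by ring.
    rewrite powRB; last by apply/implyP => _; rewrite gt_eqF.
    have : 0 < (1 - x) `^ (h - 1) by rewrite powR_gt0.
    rewrite powRr1 ?ltW//; move: ((1 - x) `^ _) => p p0.
    have x10 : x - 1 != 0 by rewrite subr_eq0 -subr_eq0 -opprB oppr_eq0 gt_eqF.
    by field; rewrite x10 !gt_eqF.
have : 2 * c * g 1 - c ^+ 2 * 0 - c * g 1 * 2 `^ h = 0.
  by rewrite -(cvg_lim _ Glim)// (cvg_lim _ Glim0).
move=> E; apply/negP: h1; rewrite negbK; apply/eqP/powR2_eq2.
have cg1 : c * g 1 != 0 by rewrite mulf_neq0// gt_eqF.
apply: (mulfI cg1); apply/eqP; rewrite -subr_eq0 -oppr_eq0 -[X in _ == X]E.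
by apply/eqP; ring.
Unshelve. all: by end_near. Qed.

End covariance_ratio.

(** * Gaussian laws *)

Section normal_standard.
Context {R : realType}.
Implicit Types m s a x : R.
Notation mu := lebesgue_measure.

Lemma setI_closed_rays : setI_closed (@RGenCInfty.G R).
Proof.
move=> _ _ [x ->] [y ->]; exists (Num.max x y).
apply/seteqP; split => z /=; rewrite !in_itv/= !andbT ge_max.
  by move=> [-> ->].
by move=> /andP[].
Qed.

(** The closed rays are stable under intersection and generate the Borel sets, and those starting at
    [- n] exhaust the line, so uniqueness of measures applies. *)
Lemma eq_probability_rays (p q : probability (measurableTypeR R) R) :
  (forall x, p `[x, +oo[%classic = q `[x, +oo[%classic) ->
  forall A, measurable A -> p A = q A.
Proof.
move=> pq A mA.
apply: (@measure_unique _ R (measurableTypeR R) (@RGenCInfty.G R) (fun n => `[- n%:R, +oo[%classic)) => //.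
- exact: RGenCInfty.measurableE.
- exact: setI_closed_rays.
- by move=> n; exists (- n%:R).
- apply/seteqP; split => // x _; exists (Num.bound `|x|) => //=.
  rewrite in_itv/= andbT lerNl ltW// (le_lt_trans (ler_norm _))// normrN.
  exact: archi_boundP.
- by move=> _ [x ->]; exact: pq.
- by move=> n; rewrite (le_lt_trans (probability_le1 _ _))// ltry.
Qed.

Lemma normal_pdf_affine m s x : 0 < s ->
  normal_pdf m s x = normal_pdf 0 1 ((x - m) / s) * s^-1.
Proof.
move=> s0; rewrite !normal_pdfE ?oner_eq0 ?gt_eqF//.
rewrite mulrAC; congr (_ * _).
  rewrite /normal_peak expr1n mul1r -invfM; congr (_^-1).
  by rewrite -mulrnAr sqrtrM ?sqr_ge0// sqrtr_sqr gtr0_norm// mulrC.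
rewrite /normal_fun subr0 expr1n; congr expR.
by field; rewrite gt_eqF.
Qed.

(** Increasing substitution [F x = (x - m) / s] on a ray; its derivative [s^-1] is the factor
    relating the two densities. Rays suffice by [eq_probability_rays]. *)
Lemma normal_prob_affine m s a : 0 < s ->
  normal_prob m s `[a, +oo[ = normal_prob 0 1 `[(a - m) / s, +oo[.
Proof.
move=> s0; rewrite /normal_prob.
pose F x := (x - m) / s.
have dF x : is_derive x 1 F s^-1.
  by rewrite /F; apply: is_derive_eq; rewrite /GRing.scale/=; ring.
have F' : F^`()%classic = cst s^-1.
  by apply/funext => x; rewrite derive1E derive_val.
have cN := @continuous_normal_pdf R 0 1 (oner_neq0 _).
rewrite -/(F a) (@increasing_ge0_integration_by_substitutiony R F) //.
- by apply: eq_integral => x _; rewrite F' normal_pdf_affine.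
- by move=> x y _ _ xy; rewrite /F ltr_pM2r ?invr_gt0// ltrD2r.
- by rewrite F' => x _; exact: cvg_cst.
- by rewrite F'; exact: is_cvg_cst.
- by rewrite F'; exact: is_cvg_cst.
- split; first by move=> x _; exact: ex_derive.
  apply: cvg_at_right_filter; apply: differentiable_continuous.
  by apply/derivable1_diffP; exact: ex_derive.
- by apply: gt0_cvgMly; [rewrite invr_gt0|exact: cvg_addrr].
- exact: continuous_subspaceT.
- by move=> x _; exact: normal_pdf_ge0.
Qed.

(** [gaussian_rv] leaves the sign of [s] free, while the density depends on [s] only through
    [s ^+ 2]. *)
Lemma normal_prob_normr m s A : normal_prob m s A = normal_prob m `|s| A.
Proof.
rewrite /normal_prob; apply: eq_integral => x _.
rewrite /normal_pdf normr_eq0; case: ifP => // _.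
by rewrite /normal_peak /normal_fun real_normK// num_real.
Qed.

Lemma normal_prob_set1 m s x : normal_prob m s [set x] = 0%E.
Proof. by rewrite /normal_prob integral_set1. Qed.

End normal_standard.

(** * Standardization of Gaussian laws *)

Section gaussian_laws.
Context {d : measure_display} {T : measurableType d} {R : realType}.
Variable P : probability T R.
Implicit Types X : T -> R.

(** Reducing every nondegenerate Gaussian law to one fixed law allows two of them to be compared
    without computing a moment of [normal_prob]. *)
Lemma gaussian_standardize X : measurable_fun setT X -> gaussian_rv P X ->
  (exists m, forall A, measurable A -> P (X @^-1` A) = \d_m A) \/
  (exists m s, 0 < s /\ forall A, measurable A ->
    P ((fun w => (X w - m) / s) @^-1` A) = normal_prob 0 1 A).
Proof.
move=> mX [m [s XE]].
have [s0|s0] := eqVneq s 0.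
  by left; exists m => A mA; have := XE A mA; rewrite s0 eqxx.
right; exists m, `|s|; split; first by rewrite normr_gt0.
have mN : measurable_fun setT (fun w => (X w - m) / `|s|).
  by apply: measurable_funM => //; exact: measurable_funB.
(* The same function with its codomain retyped as [measurableTypeR R], where [eq_probability_rays]
   compares probabilities. *)
have mN' : @measurable_fun _ _ T (measurableTypeR R) setT
  (fun w => (X w - m) / `|s|) := mN.
pose N : {RV P >-> measurableTypeR R} :=
  @mfun_Sub _ _ T (measurableTypeR R) _ (mem_set mN').
move=> A mA.
have := @eq_probability_rays R (distribution P N) (normal_prob 0 1) _ A mA.
apply => x.
transitivity (pushforward P X `[x * `|s| + m, +oo[%classic).
  rewrite /distribution /pushforward /=; congr (P _); apply/seteqP; split => w /=; rewrite !in_itv/= !andbT.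
    by rewrite ler_pdivlMr ?normr_gt0// lerBrDr.
  by rewrite ler_pdivlMr ?normr_gt0// lerBrDr.
rewrite XE// (negbTE s0) normal_prob_normr normal_prob_affine ?normr_gt0//.
by rewrite addrK mulfK// normr_eq0.
Qed.

Lemma eq_law_integral X1 X2 (f : R -> R) :
  measurable_fun setT X1 -> measurable_fun setT X2 ->
  (forall A, measurable A -> P (X1 @^-1` A) = P (X2 @^-1` A)) ->
  measurable_fun setT f ->
  P.-integrable setT (EFin \o (f \o X1)) -> P.-integrable setT (EFin \o (f \o X2)) ->
  (\int[P]_w (f (X1 w))%:E = \int[P]_w (f (X2 w))%:E)%E.
Proof.
move=> m1 m2 E mf i1 i2.
have me : measurable_fun setT (EFin \o f) by exact/measurable_EFinP.
have := @integral_pushforward _ _ _ _ _ _ m1 P setT _ me.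
rewrite preimage_setT => <-//.
have := @integral_pushforward _ _ _ _ _ _ m2 P setT _ me.
rewrite preimage_setT => <-//.
by apply: eq_measure_integral => A mA _; exact: E.
Qed.

End gaussian_laws.

(** * Square-integrable variables and centered Gaussian laws *)

Section gaussian_second_order.
Context {d : measure_display} {T : measurableType d} {R : realType}.
Variable P : probability T R.
Implicit Types X f g : T -> R.

Lemma integrable_EFinD f g : P.-integrable setT (EFin \o f) ->
  P.-integrable setT (EFin \o g) ->
  P.-integrable setT (EFin \o (fun w => f w + g w)).
Proof.
by move=> i j; rewrite (_ : _ \o _ = (EFin \o f) \+ (EFin \o g))%E //; exact: integrableD.
Qed.

Lemma integrable_EFinB f g : P.-integrable setT (EFin \o f) ->
  P.-integrable setT (EFin \o g) ->
  P.-integrable setT (EFin \o (fun w => f w - g w)).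
Proof.
by move=> i j; rewrite (_ : _ \o _ = (EFin \o f) \- (EFin \o g))%E //; exact: integrableB.
Qed.

Lemma integrable_EFinZ k f : P.-integrable setT (EFin \o f) ->
  P.-integrable setT (EFin \o (fun w => k * f w)).
Proof.
move=> i; rewrite (_ : _ \o _ = (fun w => k%:E * (EFin \o f) w))%E //.
exact: integrableZl.
Qed.

Definition sq_integrable X :=
  measurable_fun setT X /\ P.-integrable setT (EFin \o (fun w => X w ^+ 2)).

Lemma sq_integrable_mul X1 X2 : sq_integrable X1 -> sq_integrable X2 ->
  P.-integrable setT (fun w => (X1 w * X2 w)%:E).
Proof.
move=> [m1 i1] [m2 i2].
have i : P.-integrable setT (fun w => (X1 w ^+ 2 + X2 w ^+ 2)%:E).
  by under eq_fun do rewrite EFinD; exact: integrableD.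
apply: le_integrable i => //.
  by apply/measurable_EFinP; exact: measurable_funM.
move=> w _; rewrite /= lee_fin normrM [leRHS]ger0_norm ?addr_ge0 ?sqr_ge0//.
rewrite -(real_normK (num_real (X1 w))) -(real_normK (num_real (X2 w))).
by have := sqr_ge0 (`|X1 w| - `|X2 w|); have := normr_ge0 (X1 w);
  have := normr_ge0 (X2 w); nra.
Qed.

Lemma integrable_cst_prob (c : R) : P.-integrable setT (fun=> c%:E).
Proof. exact: finite_measure_integrable_cst. Qed.

Lemma sq_integrable_cst c : sq_integrable (fun=> c).
Proof. by split => //; exact: integrable_cst_prob. Qed.

Lemma sq_integrable_integrable X : sq_integrable X ->
  P.-integrable setT (EFin \o X).
Proof.
move=> /sq_integrable_mul /(_ (sq_integrable_cst 1)).
by under eq_fun do rewrite mulr1.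
Qed.

Lemma sq_integrableZ k X : sq_integrable X -> sq_integrable (fun w => k * X w).
Proof.
move=> [mX iX]; split; first exact: measurable_funM.
rewrite (_ : _ \o _ = (fun w => (k ^+ 2)%:E * (X w ^+ 2)%:E)%E).
  exact: integrableZl.
by apply/funext => w /=; rewrite exprMn EFinM.
Qed.

Lemma sq_integrableD X1 X2 : sq_integrable X1 -> sq_integrable X2 ->
  sq_integrable (fun w => X1 w + X2 w).
Proof.
move=> s1 s2; split; first by apply: measurable_funD; [case: s1|case: s2].
rewrite (_ : _ \o _ = (fun w => ((X1 w ^+ 2)%:E + 2%:E * (X1 w * X2 w)%:E) +
   (X2 w ^+ 2)%:E)%E).
  apply: integrableD => //; [apply: integrableD => //|by case: s2].
    by case: s1.
  by apply: integrableZl => //; exact: sq_integrable_mul.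
by apply/funext => w /=; rewrite -!EFinM -!EFinD; congr _%:E; ring.
Qed.

(** A Dirac law at [m] makes [X] almost surely equal to [m]; the mean gives [m = 0], and the second
    moment would then vanish. This excludes the degenerate case of [gaussian_standardize]. *)
Lemma centered_not_dirac X : sq_integrable X ->
  \int[P]_w X w = 0 -> \int[P]_w (X w ^+ 2) != 0 ->
  ~ exists m, forall A, measurable A -> P (X @^-1` A) = \d_m A.
Proof.
move=> [mX iX] EX EX2 [m PX].
have ae (f : R -> R) : measurable_fun setT f -> \int[P]_w f (X w) = f m.
  move=> mf; transitivity (\int[P]_w cst (f m) w).
    rewrite /Rintegral; congr fine; apply: ae_eq_integral => //.
    - by apply/measurable_EFinP; exact: measurableT_comp.
    - exact/measurable_EFinP.
    - exists (X @^-1` [set~ m]); split.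
      + by rewrite -[Y in measurable Y]setTI; apply: mX => //; exact: measurableC.
      + apply: (etrans (PX [set~ m] _)); first exact: measurableC.
        by rewrite diracE memNset//= => /(_ erefl).
      + by move=> w /= wX /= Xm; apply: wX; rewrite Xm.
  by rewrite Rintegral_cst//= probability_setT mulr1.
have m0 : m = 0 by rewrite -EX (ae id).
by move: EX2; rewrite (ae (fun x => x ^+ 2)) ?m0 ?expr0n ?eqxx.
Qed.

Lemma standardized_moments X m s : sq_integrable X -> s != 0 ->
  \int[P]_w X w = 0 ->
  \int[P]_w ((X w - m) / s) = - m / s /\
  \int[P]_w ((X w - m) / s) ^+ 2 = (\int[P]_w (X w ^+ 2) + m ^+ 2) / s ^+ 2.
Proof.
move=> sX s0 EX.
have iX := sq_integrable_integrable _ sX.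
have i2 : P.-integrable setT (EFin \o (fun w => X w ^+ 2)) by case: sX.
have ic c : P.-integrable setT (EFin \o cst c) by exact: integrable_cst_prob.
have Ec c : \int[P]_w cst c w = c :> R.
  by rewrite Rintegral_cst//= probability_setT mulr1.
split.
  transitivity (\int[P]_w (s^-1 * (X w - cst m w))).
    by apply: eq_Rintegral => w _; rewrite mulrC.
  rewrite RintegralZl//; last exact: integrable_EFinB.
  by rewrite RintegralB// EX Ec sub0r mulrC.
have i3 : P.-integrable setT (EFin \o (fun w => 2 * m * X w)).
  exact: integrable_EFinZ.
transitivity (\int[P]_w ((s ^+ 2)^-1 * ((X w ^+ 2 - 2 * m * X w) + cst (m ^+ 2) w))).
  by apply: eq_Rintegral => w _ /=; field.
have i4 : P.-integrable setT (EFin \o (fun w => X w ^+ 2 - 2 * m * X w)).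
  exact: integrable_EFinB.
rewrite RintegralZl//; last exact: integrable_EFinD.
by rewrite RintegralD// RintegralB// RintegralZl// EX Ec mulr0 subr0 mulrC.
Qed.

(** The variables [(X1 - m1) / r1] and [(X2 - m2) / r2] have the same standard law, hence equal
    first and second moments. With a common variance [v != 0], these two equations force [r1 = r2]
    and then [m1 = m2]. *)
Lemma centered_gaussian_eq_law X1 X2 :
  sq_integrable X1 -> sq_integrable X2 ->
  gaussian_rv P X1 -> gaussian_rv P X2 ->
  \int[P]_w X1 w = 0 -> \int[P]_w X2 w = 0 ->
  \int[P]_w (X1 w ^+ 2) = \int[P]_w (X2 w ^+ 2) ->
  \int[P]_w (X1 w ^+ 2) != 0 ->
  forall A, measurable A -> P (X1 @^-1` A) = P (X2 @^-1` A).
Proof.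
move=> s1 s2 g1 g2 E1 E2 V V0 A mA.
have [|[m1 [r1 [r1_gt0 L1]]]] := gaussian_standardize _ _ s1.1 g1.
  by move/(centered_not_dirac _ s1 E1 V0).
have [|[m2 [r2 [r2_gt0 L2]]]] := gaussian_standardize _ _ s2.1 g2.
  by rewrite V in V0; move/(centered_not_dirac _ s2 E2 V0).
have r1_neq0 := lt0r_neq0 r1_gt0; have r2_neq0 := lt0r_neq0 r2_gt0.
have [M1 Q1] := standardized_moments _ m1 _ s1 r1_neq0 E1.
have [M2 Q2] := standardized_moments _ m2 _ s2 r2_neq0 E2.
have sN X m r : sq_integrable X -> sq_integrable (fun w => (X w - m) / r).
  move=> sX; under eq_fun do rewrite mulrC.
  apply: sq_integrableZ; apply: sq_integrableD => //.
  exact: sq_integrable_cst.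
have LN B : measurable B -> P ((fun w => (X1 w - m1) / r1) @^-1` B) =
    P ((fun w => (X2 w - m2) / r2) @^-1` B).
  by move=> mB; rewrite L1// L2.
have [mN1 iN1] := sN _ m1 r1 s1; have [mN2 iN2] := sN _ m2 r2 s2.
have : - m1 / r1 = - m2 / r2.
  rewrite -M1 -M2; congr fine; apply: (eq_law_integral _ _ _ id) => //.
  - by have := sq_integrable_integrable _ (sN _ m1 r1 s1).
  - by have := sq_integrable_integrable _ (sN _ m2 r2 s2).
have : (\int[P]_w (X1 w ^+ 2) + m1 ^+ 2) / r1 ^+ 2 =
       (\int[P]_w (X2 w ^+ 2) + m2 ^+ 2) / r2 ^+ 2.
  rewrite -Q1 -Q2; congr fine; apply: (eq_law_integral _ _ _ (fun x => x ^+ 2)) => //.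
rewrite -V; move: V0; set v := \int[P]_w _ => v0 vE mE.
(* Squaring the equality of means gives [m1^2 / r1^2 = m2^2 / r2^2], which cancels in the equality
   of second moments. *)
have vr : v / r1 ^+ 2 = v / r2 ^+ 2.
  have := congr1 (fun x => x ^+ 2) mE.
  rewrite !exprMn !sqrrN !exprVn => mE2.
  by apply: (addIr (m1 ^+ 2 / r1 ^+ 2)); rewrite -mulrDl vE mulrDl mE2.
have rr : r1 = r2.
  move/(mulfI v0)/invr_inj : vr => /eqP.
  by rewrite eqrXn2 ?ltW// => /eqP.
have mm : m1 = m2.
  by move: mE; rewrite rr => /mulIf; rewrite invr_eq0 => /(_ r2_neq0)/oppr_inj.
pose B := (fun x => r1 * x + m1) @^-1` A.
have mB : measurable B.
  have mf : measurable_fun setT (fun x : R => r1 * x + m1).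
    by apply: measurable_funD => //; exact: mulrl_measurable.
  by rewrite /B -[Y in measurable Y]setTI; exact: mf.
have := LN _ mB; rewrite /B -rr -mm /preimage/=.
have back X : [set w | A (r1 * ((X w - m1) / r1) + m1)] = X @^-1` A.
  by apply/seteqP; split => w /=; rewrite mulrC divfK// subrK.
by rewrite !back.
Qed.

(** Standardization turns the event into a single point under a law with a density. *)
Lemma centered_gaussian_set1 X x : sq_integrable X -> gaussian_rv P X ->
  \int[P]_w X w = 0 -> \int[P]_w (X w ^+ 2) != 0 -> P (X @^-1` [set x]) = 0%E.
Proof.
move=> sX gX EX VX.
have [|[m [r [r_gt0 L]]]] := gaussian_standardize _ _ sX.1 gX.
  by move/(centered_not_dirac _ sX EX VX).
rewrite -(normal_prob_set1 0 1 ((x - m) / r)) -L//.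
congr (P _); apply/seteqP; split => w /=; first by move=> ->.
by move/(mulIf (invr_neq0 (lt0r_neq0 r_gt0)))/addIr.
Qed.

End gaussian_second_order.

(** * Orthogonality and conditional expectation *)

Section integral_against_preimages.
Context {d : measure_display} {T : measurableType d} {R : realType}.
Variable P : probability T R.
Implicit Types f g h : T -> R.
Local Open Scope ereal_scope.

Import HBSimple HBNNSimple.

(** [s \o h] is a finite combination of indicators of preimages under [h], each orthogonal to [g] by
    hypothesis. *)
Lemma integral_sfun_comp_mul_eq0 (s : {nnsfun R >-> R}) g h :
  measurable_fun setT h ->
  P.-integrable setT (EFin \o g) ->
  (forall C, measurable C -> \int[P]_(w in h @^-1` C) (g w)%:E = 0) ->
  \int[P]_w (s (h w) * g w)%:E = 0.
Proof.
move=> mh ig gC.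
pose F (y : R) w := y%:E * ((EFin \o g) \_ (h @^-1` (s @^-1` [set y]))) w.
have mA y : measurable (h @^-1` (s @^-1` [set y])).
  rewrite -[X in measurable X]setTI; apply: mh => //.
have iF y : P.-integrable setT (F y).
  apply: integrableZl => //.
  by apply/(integrable_mkcond _ (mA y)); apply: (integrableS measurableT _ _ ig).
transitivity (\int[P]_w \sum_(y <- finmap.enum_fset (fset_set (range s))) F y w).
  apply: eq_integral => w _; rewrite fimfunE fsbig_finite//=.
  rewrite mulr_suml -sumEFin; apply: eq_bigr => y _.
  rewrite /F /= -mulrA EFinM; congr (_ * _).
  rewrite indicE patchE; case: ifPn => /=.
    by move=> /set_mem/= <-; rewrite mem_set// mul1r.
  move=> hy; rewrite memNset ?mul0r// => shw.
  by move/negP: hy; apply; rewrite inE.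
rewrite integral_sum//; rewrite big1// => y _.
rewrite /F integralZl//; last first.
  by apply/(integrable_mkcond _ (mA y)); apply: (integrableS measurableT _ _ ig).
by rewrite -integral_mkcond gC ?mule0.
Qed.

(** Simple functions increasing to the positive part on the line are composed with [h]; dominated
    convergence applies with the bound [|h g|]. *)
Let integral_pos_part_mul_eq0 g h :
  measurable_fun setT h ->
  P.-integrable setT (EFin \o g) ->
  P.-integrable setT (fun w => (h w * g w)%:E) ->
  (forall C, measurable C -> \int[P]_(w in h @^-1` C) (g w)%:E = 0) ->
  \int[P]_w (Num.max (h w) 0 * g w)%:E = 0.
Proof.
move=> mh ig ihg gC.
have mg : measurable_fun setT g by have /measurable_int/measurable_EFinP := ig.
pose m (x : R) := (Num.max x 0)%:E.
have mm : measurable_fun setT m.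
  by apply/measurable_EFinP; apply: measurable_maxr.
have m0 x : setT x -> 0 <= m x by rewrite lee_fin le_max lexx orbT.
pose s := nnsfun_approx measurableT mm.
have [|||||_ _] := @dominated_convergence _ _ _ P _ measurableT
  (fun n w => (s n (h w) * g w)%:E) (fun w => (Num.max (h w) 0 * g w)%:E)
  (fun w => `|(h w * g w)%:E|).
- move=> n; apply/measurable_EFinP; apply: measurable_funM => //.
  by apply: measurableT_comp.
- apply/measurable_EFinP; apply: measurable_funM => //.
  exact: measurable_maxr.
- apply/aeW => w _.
  have /fine_cvgP[_] := @cvg_nnsfun_approx _ _ _ _ measurableT _ mm m0 (h w) I.
  move=> sc; apply: cvg_EFin; first by near=> n.
  by apply: cvgMl.
- exact: integrable_abse.
- apply/aeW => w n _; rewrite /= lee_fin !normrM ler_wpM2r//.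
  have := @le_approx _ _ _ _ _ n (h w) m0 I.
  rewrite -(nnsfun_approxE measurableT mm) /m lee_fin => sm.
  rewrite ger0_norm//; apply: (le_trans sm); rewrite ge_max normr_ge0 andbT.
  exact: ler_norm.
rewrite (_ : (fun n => _) = (fun=> 0)); last first.
  by apply/funext => n; exact: integral_sfun_comp_mul_eq0.
by move=> /cvg_lim <-//; rewrite lim_cst.
Unshelve. all: by end_near. Qed.

(** Integral form of the implication from [E[g | h] = 0] to [E[h g] = 0], without constructing a
    conditional expectation. The positive and negative parts of [h] are treated separately. *)
Lemma integral_mul_eq0 g h :
  measurable_fun setT h ->
  P.-integrable setT (EFin \o g) ->
  P.-integrable setT (fun w => (h w * g w)%:E) ->
  (forall C, measurable C -> \int[P]_(w in h @^-1` C) (g w)%:E = 0) ->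
  \int[P]_w (h w * g w)%:E = 0.
Proof.
move=> mh ig ihg gC.
have mg : measurable_fun setT g by have /measurable_int/measurable_EFinP := ig.
have := integral_pos_part_mul_eq0 _ _ mh ig ihg gC.
have := integral_pos_part_mul_eq0 g (fun w => - h w)%R _ ig _ _.
have ihgN : P.-integrable setT (fun w => (- h w * g w)%:E).
  by under eq_fun do rewrite mulNr EFinN; exact: integrableN.
have le_max_norm (x : R) : (`|Num.max x 0| <= `|x|)%R.
  rewrite ger0_norm ?le_max ?lexx ?orbT// ge_max normr_ge0 andbT.
  exact: ler_norm.
have mN : measurable_fun setT (fun w => - h w)%R by exact: measurableT_comp.
have imax (k : T -> R) : measurable_fun setT k -> P.-integrable setT (fun w => (k w * g w)%:E) ->
    P.-integrable setT (fun w => (Num.max (k w) 0 * g w)%:E).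
  move=> mk; apply: le_integrable => //.
    apply/measurable_EFinP; apply: measurable_funM => //.
    exact: measurable_maxr.
  by move=> w _; rewrite /= lee_fin !normrM ler_wpM2r.
move=> /(_ mN ihgN).
have gCN C : measurable C -> \int[P]_(w in (fun w => - h w)%R @^-1` C) (g w)%:E = 0.
  move=> mC; apply: (gC (-%R @^-1` C)).
  by rewrite -[X in measurable X]setTI; exact: oppr_measurable.
move=> /(_ gCN) E1 E2.
transitivity (\int[P]_w ((Num.max (h w) 0 * g w)%:E - (Num.max (- h w) 0 * g w)%:E)).
  apply: eq_integral => w _; rewrite -EFinB -mulrBl; congr (_ * _)%:E.
  rewrite /Num.max oppr_lt0; case: ltgtP => //; rewrite ?subr0 ?opprK ?add0r//.
  by move=> ->; rewrite addr0.
by rewrite integralB//= ?E1 ?E2 ?sube0//; exact: imax.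
Qed.
End integral_against_preimages.

(** * Uncorrelated jointly Gaussian variables *)

Section uncorrelated_gaussian.
Context {d : measure_display} {T : measurableType d} {R : realType}.
Variable P : probability T R.

(** For [y != 0] the quotient is constant as soon as [|u| / (n + 1) < |y|], since neither argument
    then changes sign. At [y = 0] symmetry makes it [0], in accordance with the value [0] of
    [Num.sg] at [0]. *)
Lemma cvg_abs_symmetric_quotient (y u : R) :
  (`|y + n.+1%:R^-1 * u| - `|y - n.+1%:R^-1 * u|) / (2 * n.+1%:R^-1)
    @[n --> \oo] --> u * Num.sg y.
Proof.
have [->|y0] := eqVneq y 0.
  rewrite sgr0 mulr0; under eq_fun do rewrite add0r sub0r normrN subrr mul0r.
  exact: cvg_cst.
have small : \forall n \near \oo, `|n.+1%:R^-1 * u| < `|y|.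
  have : n.+1%:R^-1 * u @[n --> \oo] --> (0 : R).
    by rewrite -(mul0r u); apply: cvgMl; exact: cvg_harmonic.
  move=> /cvgrPdist_lt /(_ `|y|); rewrite normr_gt0 => /(_ y0).
  by apply: filterS => n; rewrite sub0r normrN.
apply: cvg_near_cst; apply: filterS small => n.
have : (n.+1%:R^-1 : R) != 0 by rewrite invr_eq0 pnatr_eq0.
move: (n.+1%:R^-1 : R) => c c0; rewrite ltr_norml => /andP[cu1 cu2].
have [ypos|yneg|yz] := ltgtP y 0; last by rewrite yz eqxx in y0.
  rewrite ltr0_norm// in cu1 cu2.
  rewrite !ltr0_norm//; [|lra|lra].
  by rewrite ltr0_sg//; field.
rewrite gtr0_norm// in cu1 cu2.
rewrite !gtr0_norm//; [|lra|lra].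
by rewrite gtr0_sg//; field.
Qed.

(** Reverse triangle inequality. It provides the dominating function [|U|] for differentiation under
    the integral. *)
Lemma abs_symmetric_quotient_le (y u c : R) : 0 < c ->
  `|(`|y + c * u| - `|y - c * u|) / (2 * c)| <= `|u|.
Proof.
move=> c0; rewrite normrM normrV ?unitfE ?mulf_neq0 ?gt_eqF//.
rewrite ler_pdivrMr ?normr_gt0 ?mulf_neq0 ?gt_eqF//.
rewrite (gtr0_norm (mulr_gt0 _ c0))//.
apply: le_trans (ler_dist_dist _ _) _.
rewrite (_ : _ - _ = 2 * c * u); last by ring.
by rewrite !normrM (gtr0_norm c0) (gtr0_norm (ltr0n R 2)) mulrC.
Qed.

Variables U Y : T -> R.
Hypotheses (sU : sq_integrable P U) (sY : sq_integrable P Y).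
Hypothesis gaussYU : forall c, gaussian_rv P (fun w => Y w + c * U w).
Hypotheses (EU : \int[P]_w U w = 0) (EY : \int[P]_w Y w = 0).
Hypotheses (EUY : \int[P]_w (U w * Y w) = 0) (EY2 : \int[P]_w (Y w ^+ 2) != 0).

Let sV c : sq_integrable P (fun w => Y w + c * U w).
Proof. by apply: sq_integrableD => //; exact: sq_integrableZ. Qed.

Let iU : P.-integrable setT (EFin \o U).
Proof. exact: sq_integrable_integrable. Qed.

Let iY : P.-integrable setT (EFin \o Y).
Proof. exact: sq_integrable_integrable. Qed.

Let EUe : (\int[P]_w (U w)%:E = 0)%E.
Proof.
by rewrite -[LHS]fineK; [congr _%:E|exact: integrable_fin_num].
Qed.

Let EV c : \int[P]_w (Y w + c * U w) = 0.
Proof.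
rewrite RintegralD//; last exact: integrable_EFinZ.
by rewrite RintegralZl// EU EY mulr0 addr0.
Qed.

(** The cross term vanishes because [U] and [Y] are uncorrelated, so the variance is even in [c];
    this is what makes [Y + c U] and [Y - c U] equal in law. *)
Let EV2 c : \int[P]_w ((Y w + c * U w) ^+ 2) =
  \int[P]_w (Y w ^+ 2) + c ^+ 2 * \int[P]_w (U w ^+ 2).
Proof.
have iUY := sq_integrable_mul _ _ _ sU sY.
transitivity (\int[P]_w (Y w ^+ 2 + (c ^+ 2 * U w ^+ 2 + 2 * c * (U w * Y w)))).
  by apply: eq_Rintegral => w _; ring.
have iU2 : P.-integrable setT (EFin \o (fun w => c ^+ 2 * U w ^+ 2)).
  by apply: integrable_EFinZ; case: sU.
have iUY2 : P.-integrable setT (EFin \o (fun w => 2 * c * (U w * Y w))).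
  exact: integrable_EFinZ.
rewrite RintegralD//; [|by case: sY|exact: integrable_EFinD].
rewrite RintegralD// RintegralZl//; last by case: sU.
by rewrite RintegralZl// EUY mulr0 addr0.
Qed.

Let EV2_neq0 c : \int[P]_w ((Y w + c * U w) ^+ 2) != 0.
Proof.
rewrite EV2 gt_eqF// ltr_pwDl//.
  by rewrite lt_neqAle eq_sym EY2 Rintegral_ge0// => w _; exact: sqr_ge0.
by rewrite mulr_ge0 ?sqr_ge0// Rintegral_ge0// => w _; exact: sqr_ge0.
Qed.

Let iabs c q : P.-integrable setT (EFin \o (fun w => `|Y w + c * U w - q|)).
Proof.
apply: integrable_norm => //; apply: integrable_EFinB.
  exact: sq_integrable_integrable.
exact: integrable_cst_prob.
Qed.

Let integral_abs_opp c q :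
  (\int[P]_w (`|Y w + c * U w - q|)%:E = \int[P]_w (`|Y w - c * U w - q|)%:E)%E.
Proof.
under [RHS]eq_integral do rewrite -mulNr.
apply: (eq_law_integral P (fun w => Y w + c * U w) (fun w => Y w + - c * U w)
  (fun x => `|x - q|)).
- by case: (sV c).
- by case: (sV (- c)).
- apply: (centered_gaussian_eq_law P _ _ (sV c) (sV (- c))) => //.
  by rewrite !EV2 sqrrN.
- by apply: measurableT_comp => //; exact: measurable_funB.
- exact: iabs.
- exact: iabs.
Qed.

(** Derivative at [c = 0] of [integral_abs_opp], taken along [c = 1 / (n + 1)]: each symmetric
    quotient has integral zero, and dominated convergence passes to the limit, also giving its
    integrability. *)
Let integral_sg q :
  P.-integrable setT (fun w => (U w * Num.sg (Y w - q))%:E) /\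
  (\int[P]_w (U w * Num.sg (Y w - q))%:E = 0)%E.
Proof.
have [mU _] := sU; have [mY _] := sY.
pose f n w := (`|Y w - q + n.+1%:R^-1 * U w| - `|Y w - q - n.+1%:R^-1 * U w|)
  / (2 * n.+1%:R^-1).
have fE n w : f n w = (2 * n.+1%:R^-1)^-1 * (`|Y w + n.+1%:R^-1 * U w - q| -
    `|Y w - n.+1%:R^-1 * U w - q|).
  by rewrite /f mulrC addrAC (addrAC (Y w) (- q)).
have ir n : P.-integrable setT (EFin \o f n).
  rewrite (funext (fE n)).
  apply: integrable_EFinZ; apply: integrable_EFinB; first exact: iabs.
  by under eq_fun do rewrite -mulNr; exact: iabs.
have [|||||isg _] := @dominated_convergence _ _ _ P _ measurableT
  (fun n w => (f n w)%:E) (fun w => (U w * Num.sg (Y w - q))%:E)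
  (fun w => `|(U w)%:E|%E).
- by move=> n; have /measurable_int := ir n.
- apply/measurable_EFinP; apply: (@measurable_fun_cvg _ _ _ _ f).
    by move=> n; have /measurable_int/measurable_EFinP := ir n.
  by move=> w _; exact: cvg_abs_symmetric_quotient.
- apply/aeW => w _; apply: cvg_EFin; first by near=> n.
  exact: cvg_abs_symmetric_quotient.
- exact: integrable_abse.
- by apply/aeW => w n _; rewrite /= lee_fin abs_symmetric_quotient_le// invr_gt0.
rewrite (_ : (fun n => _) = (fun=> 0%E)).
  by move=> /cvg_lim <-//; rewrite lim_cst.
apply/funext => n; under eq_integral do rewrite fE EFinM.
rewrite integralZl//; last first.
  apply: integrable_EFinB; first exact: iabs.
  by under eq_fun do rewrite -mulNr; exact: iabs.
under eq_integral do rewrite EFinB.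
rewrite integralB//.
- rewrite -integral_abs_opp subee ?mule0//.
  by apply: integrable_fin_num => //; exact: iabs.
- exact: iabs.
- by under eq_fun do rewrite -mulNr; exact: iabs.
Unshelve. all: by end_near. Qed.

(** Off the null event [Y = q], the indicator of [q <= Y] is [(1 + sgn (Y - q)) / 2]; both terms are
    orthogonal to [U]. *)
Let integral_ray q : (\int[P]_(w in Y @^-1` `[q, +oo[) (U w)%:E = 0)%E.
Proof.
have [mU _] := sU; have [mY _] := sY.
have mq : measurable (Y @^-1` `[q, +oo[).
  by rewrite -[X in measurable X]setTI; exact: mY.
have [isg Esg] := integral_sg q.
rewrite integral_mkcond.
transitivity (\int[P]_w (2^-1 * (U w + U w * Num.sg (Y w - q)))%:E)%E.
  apply: ae_eq_integral => //.
  - apply/measurable_restrict => //.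
    by apply/measurable_funTS/measurable_EFinP.
  - apply/measurable_EFinP/measurable_funM => //; apply: measurable_funD => //.
    by have /measurable_int/measurable_EFinP := isg.
  exists (Y @^-1` [set q]); split.
  - by rewrite -[X in measurable X]setTI; exact: mY.
  (* [Y] is the member [c = 0] of the Gaussian family [Y + c U]. *)
  - have := centered_gaussian_set1 P (fun w => Y w + 0 * U w) q (sV 0) (gaussYU 0)
      (EV 0) (EV2_neq0 0).
    by under eq_fun do rewrite mul0r addr0.
  move=> w /= H; apply: contrapT => Yq; apply: H => _.
  rewrite patchE; case: ifPn => [/set_mem/=|/negP].
    rewrite in_itv/= andbT le_eqVlt => /predU1P[/esym//|qY].
    by rewrite gtr0_sg ?subr_gt0// mulr1; congr _%:E; field.
  rewrite inE/= in_itv/= andbT => /negP; rewrite -ltNge => qY.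
  by rewrite ltr0_sg ?subr_lt0// mulrN1 subrr mulr0.
under eq_integral do rewrite EFinM.
rewrite integralZl//; last first.
  exact: integrable_EFinD.
by under eq_integral do rewrite EFinD; rewrite integralD// Esg adde0 EUe mule0.
Qed.

(** Dynkin's theorem extends the case of rays to Borel sets; stability under complement uses that
    [U] has mean zero. *)
Lemma uncorrelated_gaussian_integral_preimage (C : set R) : measurable C ->
  (\int[P]_(w in Y @^-1` C) (U w)%:E = 0)%E.
Proof.
have [mU _] := sU; have [mY _] := sY.
move=> mC.
have mpre S : measurable S -> measurable (Y @^-1` S).
  by move=> mS; rewrite -[X in measurable X]setTI; exact: mY.
apply: (@dynkin_induction _ (measurableTypeR R) (@RGenCInfty.G R)
  (fun S => \int[P]_(w in Y @^-1` S) (U w)%:E = 0)%E) => //.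
- exact: RGenCInfty.measurableE.
- exact: setI_closed_rays.
- by move=> _ [q ->]; exact: integral_ray.
- move=> S mS S0; rewrite preimage_setC.
  have := @integral_setU _ _ _ P (Y @^-1` S) (~` (Y @^-1` S)) (EFin \o U)
    (mpre _ mS) (measurableC (mpre _ mS)).
  rewrite setUv disj_set2E setICr eqxx => /(_ (measurable_int _ iU) isT).
  by rewrite EUe S0 add0e => <-.
- move=> F mF tF F0; rewrite preimage_bigcup integral_bigcup//.
  + by rewrite eseries0// => n _ _; exact: F0.
  + move=> i j _ _ [w [/= Fi Fj]]; apply: tF => //; by exists (Y w).
  + by move=> n; apply: mpre; exact: mF.
  + apply: (integrableS measurableT _ _ iU) => //.
    by apply: bigcup_measurable => n _; apply: mpre; exact: mF.
- suff : (@RGenCInfty.G R).-sigma.-measurable C by [].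
  by rewrite -RGenCInfty.measurableE.
Qed.

End uncorrelated_gaussian.

(** * Conditional expectations of variables with values in the unit interval *)

Section conditional_expectation.
Context {d : measure_display} {T : measurableType d} {R : realType}.
Variable P : probability T R.

Lemma pos_integral0_negligible (A : set T) (f : T -> R) : measurable A ->
  P.-integrable A (EFin \o f) -> (forall w, A w -> 0 < f w) ->
  (\int[P]_(w in A) (f w)%:E = 0)%E -> P.-negligible A.
Proof.
move=> mA fi f0 If.
have : ae_eq P A (EFin \o f) (cst 0%E).
  apply/(ae_eq_integral_abs P mA); first exact: measurable_int fi.
  rewrite -[RHS]If; apply: eq_integral => w /set_mem Aw.
  by rewrite /= ger0_norm// ltW// f0.
move=> [N [mN N0 sub]]; exists N; split => // w Aw; apply: sub => /= /(_ Aw)/=.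
by move=> /eqP; rewrite eqe gt_eqF// f0.
Qed.

Lemma bounded01 (f : T -> R) :
  (forall w, 0 <= f w <= 1) -> [bounded f x | x in setT].
Proof.
move=> f01; exists 1; split=> // x x1 w _ /=; have /andP[f0 f1] := f01 w.
by rewrite ger0_norm// (le_trans f1)// ltW.
Qed.

Lemma integrable01 (f : T -> R) : measurable_fun setT f ->
  (forall w, 0 <= f w <= 1) -> P.-integrable setT (EFin \o f).
Proof.
move=> mf f01; apply: (measurable_bounded_integrable measurableT) => //.
  by rewrite (le_lt_trans (probability_le1 _ _))// ltry.
exact: bounded01.
Qed.

Variables (G : set_system T) (X m : T -> R).
Hypotheses (mX : measurable_fun setT X) (X01 : forall w, 0 <= X w <= 1).
Hypothesis condm : is_cond_expectation P G X m.

(* A version of [E[1_C(W) | Y]] is only almost surely in [0, 1]; clipping it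
   makes its product with a square integrable [U] integrable. *)
Definition clip01 (x : R) := Num.min (Num.max x 0) 1.

Lemma clip01_bound x : 0 <= clip01 x <= 1.
Proof. by rewrite /clip01 le_min ge_min ler01 lexx orbT le_max lexx orbT. Qed.

Lemma measurable_clip01 : measurable_fun setT clip01.
Proof. by apply: measurable_minr => //; exact: measurable_maxr. Qed.

Let iX : P.-integrable setT (EFin \o X).
Proof. exact: integrable01. Qed.

(** The event [1 < m] belongs to [G], so [m - X], which is positive there, has integral zero over
    it, and the event is negligible. The event [m < 0] is treated in the same way with [X - m]. *)
Lemma cond_expectation_clip01 : {ae P, forall w, m w = clip01 (m w)}.
Proof.
have [mG im mE] := condm.
have mm : measurable_fun setT m by have /measurable_int/measurable_EFinP := im.
have pre C : measurable C -> measurable (m @^-1` C).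
  by move=> mC; rewrite -[Y in measurable Y]setTI; exact: mm.
have sub (Y Z : T -> R) A : measurable A ->
    P.-integrable setT (EFin \o Y) -> P.-integrable setT (EFin \o Z) ->
    (\int[P]_(w in A) (Y w)%:E = \int[P]_(w in A) (Z w)%:E)%E ->
    (\int[P]_(w in A) (Y w - Z w)%:E = 0)%E /\
    P.-integrable A (EFin \o (fun w => Y w - Z w)).
  move=> mA iY iZ YZ.
  have iYA := integrableS measurableT mA (@subsetT _ A) iY.
  have iZA := integrableS measurableT mA (@subsetT _ A) iZ.
  split; last first.
    by apply: (integrableS measurableT mA (@subsetT _ A)); exact: integrable_EFinB.
  under eq_integral do rewrite EFinB.
  rewrite integralB// YZ subee//.
  exact: integrable_fin_num.
have hi : P.-negligible (m @^-1` `]1, +oo[).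
  have [E i] := sub _ _ _ (pre _ (measurable_itv `]1, +oo[)) im iX
    (mE _ (mG _ (measurable_itv `]1, +oo[))).
  apply: (pos_integral0_negligible _ _ _ i) => //; first exact: pre.
  move=> w /=; rewrite in_itv/= andbT subr_gt0; apply: le_lt_trans.
  by have /andP[] := X01 w.
have lo : P.-negligible (m @^-1` `]-oo, 0[).
  have [E i] := sub _ _ _ (pre _ (measurable_itv `]-oo, 0[)) iX im
    (esym (mE _ (mG _ (measurable_itv `]-oo, 0[)))).
  apply: (pos_integral0_negligible _ _ _ i) => //; first exact: pre.
  move=> w /=; rewrite in_itv/= subr_gt0 => /lt_le_trans; apply.
  by have /andP[] := X01 w.
apply: negligibleS (negligibleU hi lo) => w /= mw.
rewrite !in_itv/= andbT.
have [m1|m1] := ltP 1 (m w); first by left.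
right; rewrite ltNge; apply/negP => m0; apply: mw.
by rewrite /clip01 max_l// min_l.
Qed.

End conditional_expectation.

(** * The Markov property and the covariance of a Gaussian process *)

Section markov_gaussian.
Context {d : measure_display} {T : measurableType d} {R : realType}.
Variable P : probability T R.

Variables (G : set_system T) (U Y W : T -> R).
Hypotheses (sU : sq_integrable P U) (sW : sq_integrable P W).
Hypothesis GU : forall C : set R, measurable C -> G (U @^-1` C).
Hypothesis UY0 : forall C : set R, measurable C ->
  (\int[P]_(w in Y @^-1` C) (U w)%:E = 0)%E.
Hypothesis condW : forall C : set R, measurable C -> exists m m' : T -> R,
  [/\ is_cond_expectation P G (\1_C \o W) m,
      is_cond_expectation P (sigma_rv Y) (\1_C \o W) m'
    & {ae P, forall w, m w = m' w}].

(** Here [G] is the past, [U] the regression residual, [Y] the present and [W] the future. For a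
    Borel set [C], let [n] be the clipped version of [E[1_C(W) | Y]]. Then [E[U n] = 0] since [n]
    depends on [Y] alone, and [E[U (1_C(W) - n)] = 0] since [U] is [G]-measurable and [n] is also a
    version of [E[1_C(W) | G]]. *)
Lemma markov_residual_orthogonal : (\int[P]_w (W w * U w)%:E = 0)%E.
Proof.
have [mU _] := sU; have [mW _] := sW.
have iU := sq_integrable_integrable _ _ sU.
apply: integral_mul_eq0 => //; first exact: sq_integrable_mul.
move=> C mC.
have [m [m' [cm cm' mm']]] := condW C mC.
pose iC : T -> R := \1_C \o W.
have m1W : measurable_fun setT iC.
  by apply: measurableT_comp => //; exact: measurable_indic.
have W01 w : 0 <= iC w <= 1.
  by rewrite /iC/= indicE; case: (_ \in _); rewrite ?lexx ?ler01.
have m'n := cond_expectation_clip01 P _ _ _ m1W W01 cm'.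
have [m'Y im' _] := cm'; have [mG im mE] := cm.
have mm'_ : measurable_fun setT m' by have /measurable_int/measurable_EFinP := im'.
pose n w := clip01 (m' w).
have mn : measurable_fun setT n by exact: measurableT_comp measurable_clip01 mm'_.
have n01 w : 0 <= n w <= 1 by exact: clip01_bound.
have ibU (f : T -> R) : (forall w, 0 <= f w <= 1) -> measurable_fun setT f ->
    P.-integrable setT (fun w => (U w * f w)%:E).
  move=> f01 mf; under eq_fun do rewrite EFinM.
  exact: (integrableMl measurableT iU mf (bounded01 _ f01)).
have Un : (\int[P]_w (U w * n w)%:E = 0)%E.
  under eq_integral do rewrite mulrC.
  apply: integral_mul_eq0 => //.
    by under eq_fun do rewrite mulrC; exact: ibU.
  move=> D mD.
  have mclip : measurable (@clip01 R @^-1` D).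
    by rewrite -[Z in measurable Z]setTI; exact: measurable_clip01.
  (* Sets of [sigma_rv Y] are preimages under [Y], so the orthogonality of [U] to [Y] applies to the
     level sets of [n]. *)
  have [E mE' EE] := m'Y _ mclip.
  rewrite (_ : n @^-1` D = Y @^-1` E); first exact: UY0.
  by rewrite setTI in EE; rewrite EE.
(* Now [U] is the conditioning variable: it suffices to integrate [iC - n] over its preimages, which
   lie in [G]. *)
have Ug : (\int[P]_w (U w * (iC w - n w))%:E = 0)%E.
  apply: integral_mul_eq0 => //.
  - by apply: integrable_EFinB; exact: integrable01.
  - under eq_fun do rewrite mulrBr.
    by apply: integrable_EFinB; exact: ibU.
  move=> D mD.
  have mUD : measurable (U @^-1` D).
    by rewrite -[Z in measurable Z]setTI; exact: mU.
  have iD (f : T -> R) : P.-integrable setT (EFin \o f) ->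
      P.-integrable (U @^-1` D) (EFin \o f).
    exact: integrableS.
  under eq_integral do rewrite EFinB.
  rewrite integralB//; [|exact/iD/integrable01|exact/iD/integrable01].
  rewrite -(mE _ (GU _ mD)).
  rewrite (_ : \int[P]_(w in U @^-1` D) (m w)%:E =
               \int[P]_(w in U @^-1` D) (n w)%:E)%E.
    by rewrite subee//; apply: integrable_fin_num => //; exact/iD/integrable01.
  apply: ae_eq_integral => //.
  - by have /measurable_int := iD _ im.
  - by apply/measurable_funTS/measurable_EFinP.
  by apply: filterS2 mm' m'n => w -> E' _; rewrite E'.
rewrite integral_mkcond.
transitivity (\int[P]_w ((U w * (iC w - n w))%:E + (U w * n w)%:E))%E.
  apply: eq_integral => w _; rewrite -EFinD -mulrDr subrK patchE /iC/= indicE.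
  have -> : (w \in W @^-1` C) = (W w \in C) by apply/idP/idP => /set_mem H; apply/mem_set.
  by case: ifP => _; rewrite ?mulr1 ?mulr0.
rewrite integralD//.
- by rewrite Ug Un adde0.
- under eq_fun do rewrite mulrBr.
  by apply: integrable_EFinB; exact: ibU.
- exact: ibU.
Qed.

End markov_gaussian.

Section gaussian_markov.
Context {d : measure_display} {T : measurableType d} {R : realType}.
Variable P : probability T R.

(** Measurability is phrased through [g_sigma_algebraType] so that the closure of measurable
    functions under sums and products is available for the filtration. *)
Lemma natural_filtration_preimage (D : set R) (X : R -> T -> R) (t : R)
    (U : T -> R) :
  measurable_fun (setT : set (g_sigma_algebraType
    (\bigcup_(r in [set r | D r /\ r <= t]) sigma_rv (X r)))) U ->
  forall C : set R, measurable C -> natural_filtration D X t (U @^-1` C).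
Proof. by move=> mU C mC; rewrite -[X in natural_filtration _ _ _ X]setTI; exact: mU. Qed.

Lemma measurable_natural_filtration (D : set R) (X : R -> T -> R) (t r : R) :
  D r -> r <= t ->
  measurable_fun (setT : set (g_sigma_algebraType
    (\bigcup_(r in [set r | D r /\ r <= t]) sigma_rv (X r)))) (X r).
Proof.
move=> Dr rt _ C mC; apply: sub_sigma_algebra; exists r => //.
by exists C.
Qed.

(** The residual [U] of the regression of [X s] on [X t] is orthogonal to [X u]; expanding [E[X_u U]
    = 0] and clearing the denominator of [b] gives the identity. *)
Lemma gaussian_markov_covariance (D : set R) (X : R -> T -> R) (s t u : R) :
  D s -> D t -> D u -> s <= t -> t <= u ->
  (forall r, D r -> sq_integrable P (X r)) ->
  (forall r, D r -> \int[P]_w X r w = 0) ->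
  (forall x y, gaussian_rv P (fun w => x * X s w + y * X t w)) ->
  \int[P]_w (X t w ^+ 2) != 0 ->
  markov_process P D X ->
  (\int[P]_w (X u w * X s w)) * (\int[P]_w (X t w ^+ 2)) =
  (\int[P]_w (X s w * X t w)) * (\int[P]_w (X u w * X t w)).
Proof.
move=> Ds Dt Du st tu sX EX gX Vt mX.
(* The regression coefficient, chosen so that [E[U X_t] = 0]. *)
set b := (\int[P]_w (X s w * X t w)) / (\int[P]_w (X t w ^+ 2)).
pose U w := X s w + (- b) * X t w.
have sU : sq_integrable P U.
  by apply: sq_integrableD; [exact: sX|apply: sq_integrableZ; exact: sX].
have iX r : D r -> P.-integrable setT (EFin \o X r).
  by move=> Dr; apply: sq_integrable_integrable; exact: sX.
have iXX r q : D r -> D q -> P.-integrable setT (EFin \o (fun w => X r w * X q w)).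
  by move=> Dr Dq; apply: sq_integrable_mul; exact: sX.
have EU : \int[P]_w U w = 0.
  rewrite /U RintegralD//; [|exact: iX|apply: integrable_EFinZ; exact: iX].
  by rewrite RintegralZl ?EX ?mulr0 ?addr0//; exact: iX.
have EVU (V : T -> R) : sq_integrable P V ->
    \int[P]_w (V w * U w) = \int[P]_w (V w * X s w) - b * \int[P]_w (V w * X t w).
  move=> sV.
  have iV r : D r -> P.-integrable setT (EFin \o (fun w => V w * X r w)).
    by move=> Dr; apply: sq_integrable_mul => //; exact: sX.
  transitivity (\int[P]_w (V w * X s w + (- b) * (V w * X t w))).
    by apply: eq_Rintegral => w _; rewrite /U; ring.
  rewrite RintegralD//; [|exact: iV|apply: integrable_EFinZ; exact: iV].
  by rewrite RintegralZl ?mulNr//; exact: iV.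
have EUt : \int[P]_w (U w * X t w) = 0.
  under eq_Rintegral do rewrite mulrC.
  rewrite EVU; last exact: sX.
  under eq_Rintegral do rewrite mulrC.
  by rewrite /b divfK// subrr.
have UY0 : forall C : set R, measurable C ->
    (\int[P]_(w in X t @^-1` C) (U w)%:E = 0)%E.
  apply: uncorrelated_gaussian_integral_preimage => //; [exact: sX| |exact: EX].
  move=> c; rewrite (_ : (fun w => _) = (fun w => c * X s w + (1 - c * b) * X t w)).
    exact: gX.
  by apply/funext => w; rewrite /U; ring.
have condW (C : set R) : measurable C -> exists m m' : T -> R,
    [/\ is_cond_expectation P (natural_filtration D X t) (\1_C \o X u) m,
        is_cond_expectation P (sigma_rv (X t)) (\1_C \o X u) m'
      & {ae P, forall w, m w = m' w}].
  move=> mC; apply: mX => //.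
  exists 1; split=> // x x1 w _ /=; rewrite indicE normr_nat.
  by rewrite (le_trans _ (ltW x1))// lern1 leq_b1.
have GU : forall C : set R, measurable C -> natural_filtration D X t (U @^-1` C).
  apply: natural_filtration_preimage; apply: measurable_funD.
    exact: measurable_natural_filtration.
  apply: measurable_funM => //; exact: measurable_natural_filtration.
have := markov_residual_orthogonal P _ _ _ _ sU (sX _ Du) GU UY0 condW.
move=> /(congr1 fine) /=; rewrite -/(Rintegral _ _ _) EVU; last exact: sX.
move=> /eqP; rewrite subr_eq0 => /eqP ->.
by rewrite /b; field.
Qed.

End gaussian_markov.

(** * Moments of the generalized fractional Brownian motion *)

Section generalized_fbm.
Context {d : measure_display} {T : measurableType d} {R : realType}.
Variables (P : probability T R) (H : R) (B : R -> {RV P >-> R}).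
Hypothesis fbmB : two_sided_fbm H B.
Implicit Types a b s t : R.

Let fbm_cov s t : R :=
  2^-1 * (`|s| `^ (2 * H) + `|t| `^ (2 * H) - `|t - s| `^ (2 * H)).

(** The means vanish, so the covariance is the plain product moment. Stated in the extended reals,
    the identity also carries the finiteness that [fbm_sq_integrable] extracts. *)
Let integral_fbm_mul s t : (\int[P]_w (B t w * B s w)%:E = (fbm_cov s t)%:E)%E.
Proof.
have [_ EB CB] := fbmB.
rewrite -CB [in RHS]unlock !EB/= [in RHS]unlock.
apply: eq_integral => w _.
by transitivity ((B t w - 0) * (B s w - 0))%:E; first by rewrite !subr0.
Qed.

Lemma fbm_sq_integrable t : sq_integrable P (B t).
Proof.
split; first exact: measurable_funPT.
apply/integrableP; split.
  by apply/measurable_EFinP; apply: measurable_funX; exact: measurable_funPT.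
under eq_integral do rewrite /= ger0_norm ?sqr_ge0// expr2.
by rewrite integral_fbm_mul ltry.
Qed.

Lemma fbm_mean t : \int[P]_w B t w = 0.
Proof.
have [_ EB _] := fbmB.
by have := EB t; rewrite unlock => /(congr1 fine).
Qed.

Lemma fbm_covariance s t : \int[P]_w (B t w * B s w) = fbm_cov s t.
Proof. by have /(congr1 fine) := integral_fbm_mul s t. Qed.

Lemma gfbm_sq_integrable a b t : sq_integrable P (gfbm a b B t).
Proof.
by apply: sq_integrableD; apply: sq_integrableZ; exact: fbm_sq_integrable.
Qed.

Lemma gfbm_mean a b t : \int[P]_w gfbm a b B t w = 0.
Proof.
have iB r : P.-integrable setT (EFin \o B r).
  by apply: sq_integrable_integrable; exact: fbm_sq_integrable.
rewrite /gfbm RintegralD//; [|exact: integrable_EFinZ|exact: integrable_EFinZ].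
by rewrite !RintegralZl// !fbm_mean !mulr0 addr0.
Qed.

Lemma gfbm_gaussian a b s t x y :
  gaussian_rv P (fun w => x * gfbm a b B s w + y * gfbm a b B t w).
Proof.
have [gB _ _] := fbmB.
have := gB 4%N (fun i => [:: s; - s; t; - t]`_i)
  (fun i => [:: x * a; x * b; y * a; y * b]`_i).
rewrite (_ : (fun w => _) = (fun w => x * gfbm a b B s w + y * gfbm a b B t w))//.
by apply/funext => w; rewrite !big_ord_recl big_ord0 /= /gfbm; ring.
Qed.

(** Writing the second time as [t * y] lets self-similarity pull out [t^h] with [h = 2H]. The
    squared coefficients bring in [(t - s)^h], where [s = t * y], and the mixed terms, which pair
    times of opposite signs, bring in [(t + s)^h]. *)
Lemma gfbm_covariance a b t y : 0 <= t -> 0 <= y <= 1 ->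
  \int[P]_w (gfbm a b B t w * gfbm a b B (t * y) w) =
  2^-1 * t `^ (2 * H) * ratio_cov (2 * H) (a ^+ 2 + b ^+ 2) (2 * a * b) y.
Proof.
move=> t0 /andP[y0 y1].
have iBB r q : P.-integrable setT (EFin \o (fun w => B r w * B q w)).
  by apply: sq_integrable_mul; exact: fbm_sq_integrable.
have iBZ k r q := integrable_EFinZ P k _ (iBB r q).
pose s := t * y.
transitivity (\int[P]_w ((a ^+ 2 * (B t w * B s w) + b ^+ 2 * (B (- t) w * B (- s) w)) +
   (a * b * (B t w * B (- s) w) + a * b * (B (- t) w * B s w)))).
  by apply: eq_Rintegral => w _; rewrite /gfbm -/s; ring.
rewrite RintegralD//; [|exact: integrable_EFinD|exact: integrable_EFinD].
rewrite !RintegralD// !RintegralZl// !fbm_covariance /fbm_cov !normrN !opprK.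
have s0 : 0 <= s by rewrite mulr_ge0.
have st : s <= t by rewrite /s ler_piMr.
rewrite (_ : - t + s = - (t - s)); last by ring.
rewrite (_ : - t - s = - (t + s)); last by ring.
rewrite !normrN !ger0_norm ?subr_ge0 ?addr_ge0//.
rewrite (_ : t - s = t * (1 - y)); last by rewrite /s; ring.
rewrite (_ : t + s = t * (1 + y)); last by rewrite /s; ring.
rewrite /s !powRM ?subr_ge0 ?addr_ge0//.
by rewrite /ratio_cov /smooth_part; field.
Qed.

End generalized_fbm.

Theorem proposition1 (R : realType) (H : R) (H_gt0 : 0 < H) (H_lt1 : H < 1)
    (H_neq_half : H != 2^-1) (a b : R) (ab_neq0 : (a, b) != (0, 0))
    (d : measure_display) (T : measurableType d) (P : probability T R)
    (B : R -> {RV P >-> R}) (fbmB : two_sided_fbm H B) :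
  ~ markov_process P [set t : R | 0 <= t] (gfbm a b B).
Proof.
move=> markovZ.
set c := a ^+ 2 + b ^+ 2; set e := 2 * a * b.
have h02 : 0 < 2 * H < 2 by apply/andP; split; lra.
have h1 : 2 * H != 1.
  by apply: contra H_neq_half => /eqP hE; apply/eqP; lra.
have c0 : 0 < c.
  rewrite lt_neqAle addr_ge0 ?sqr_ge0// andbT eq_sym.
  rewrite paddr_eq0 ?sqr_ge0// !sqrf_eq0.
  by apply: contra ab_neq0 => /andP[/eqP -> /eqP ->].
(* These bounds are [(a + b)^2 >= 0] and [(a - b)^2 >= 0]. *)
have ec : `|e| <= c.
  rewrite ler_norml /e /c; apply/andP; split.
    by have := sqr_ge0 (a + b); nra.
  by have := sqr_ge0 (a - b); nra.
apply: (ratio_cov_not_multiplicative (2 * H) c e h02 h1 c0 ec) => x /andP[x0 x1].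
have x01 : 0 <= x <= 1 by rewrite !ltW.
have x0' := ltW x0.
have c1 : 0 <= (1 : R) <= 1 by rewrite ler01 lexx.
have xx01 : 0 <= x * x <= 1 by rewrite mulr_ge0// mulr_ile1// ltW.
have p0 : x `^ (2 * H) != 0 by rewrite gt_eqF// powR_gt0.
have p1 : (1 : R) `^ (2 * H) = 1 by rewrite powR1.
have r1 : ratio_cov (2 * H) c e 1 != 0.
  rewrite /ratio_cov subrr powR0 ?mulr0 ?subr0; last by case/andP: h02 => /gt_eqF ->.
  by rewrite gt_eqF// smooth_part1_gt0.
have Vx : \int[P]_w (gfbm a b B x w ^+ 2) =
    2^-1 * x `^ (2 * H) * ratio_cov (2 * H) c e 1.
  have := gfbm_covariance P H B fbmB a b x 1 x0' c1.
  by rewrite mulr1 => <-.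
have Cxx := gfbm_covariance P H B fbmB a b x x x0' x01.
have C1x := gfbm_covariance P H B fbmB a b 1 x ler01 x01.
have C1xx := gfbm_covariance P H B fbmB a b 1 (x * x) ler01 xx01.
rewrite mul1r p1 mulr1 -/c -/e in C1x; rewrite mul1r p1 mulr1 -/c -/e in C1xx.
rewrite -/c -/e in Cxx.
have sZ r : [set t : R | 0 <= t] r -> sq_integrable P (gfbm a b B r).
  by move=> _; exact: gfbm_sq_integrable fbmB _ _ _.
(* The times [x * x], [x], [1] are in geometric progression, so both steps have the same ratio [x]
   and the identity involves [ratio_cov] only at [x * x], [x] and [1]. *)
have := gaussian_markov_covariance P [set t : R | 0 <= t] (gfbm a b B) (x * x) x 1.
move=> /(_ (mulr_ge0 x0' x0') x0' ler01).
rewrite ler_piMr// ?ltW// => /(_ isT isT sZ).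
move=> /(_ (fun r _ => gfbm_mean P H B fbmB a b r)).
move=> /(_ (gfbm_gaussian P H B fbmB a b (x * x) x)).
rewrite Vx !mulf_neq0// => /(_ isT markovZ).
rewrite C1xx C1x.
under [X in _ = X * _ -> _]eq_Rintegral do rewrite mulrC.
rewrite Cxx => E.
(* The common factor of both sides: [1/2] from each covariance and [x^h] from the one whose later
   time is [x]. *)
have h20 : (2^-1 * x `^ (2 * H) * 2^-1) != 0 by rewrite !mulf_neq0.
by apply: (mulfI h20); rewrite expr2; move: E; lra.
Qed.
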